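(* Let $\mathcal K\ge 2$. Let $\mathbf{x}=(a_1,z_1,\dots,a_{\mathcal K},z_{\mathcal K})^T\in\mathbb{C}^{2\mathcal K}$ be a data point of the system $m_k=\sum_{j=1}^{\mathcal K}a_jz_j^k$ with $|z_j|=1$, $a_j\neq 0$ for all $j$, and $z_1,\dots,z_{\mathcal K}$ pairwise distinct, and let $A=\sum_{m=1}^{\mathcal K}|a_m|$. 1. There exist constants $K,C$ depending only on $\mathcal K$ such that, whenever $N\eta>K$, for $j=1,\dots,\mathcal K$, $$\kappa_{2j-1,N}(\mathbf{x})\le C A,\qquad \kappa_{2j,N}(\mathbf{x})\le C\,\frac{A}{|a_j|}\cdot\frac1N.$$ 2. If, on the other hand, all the nodes form a cluster, i.e. $N\ge 2\mathcal K$ and $N\eta^*<2\pi\mathcal K$, then, with $p^*=\lfloor N/(2\mathcal K)\rfloor$ and a constant $C'$ depending only on $\mathcal K$ and $A$, for $j=1,\dots,\mathcal K$, $$\kappa^{(p^* )}_{2j-1}(\mathbf{x})\le C'\,\frac{1}{(N\eta^{(j)})^{2\mathcal K}},\qquad \kappa^{(p^* )}_{2j}(\mathbf{x})\le C'\,\frac{1}{|a_j|}\cdot\frac{\eta^{(j)}}{(N\eta^{(j)})^{2\mathcal K}}.$$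
   Context: For $N\ge 2\mathcal K$ let $\mathcal{P}_N:\mathbb{C}^{2\mathcal K}\to\mathbb{C}^N$, $\mathcal{P}_N(a_1,z_1,\dots,a_{\mathcal K},z_{\mathcal K})=(m_0,\dots,m_{N-1})^T$, $m_k=\sum_{j=1}^{\mathcal K}a_jz_j^k$, let $\mathcal{J}_N$ be its Jacobian matrix and $\mathcal{J}_N^\dagger$ the Moore-Penrose pseudo-inverse of $\mathcal{J}_N$. Coordinate $2j-1$ is $a_j$ and coordinate $2j$ is $z_j$. When $\mathcal{J}_N(\mathbf{x})$ has full rank the condition numbers are $$\kappa_{\alpha,N}(\mathbf{x})=\sum_{i=1}^N\left|\left(\mathcal{J}_N^\dagger(\mathbf{x})\right)_{\alpha,i}\right||m_{i-1}|,\qquad \alpha=1,\dots,2\mathcal K.$$ For a positive integer $p$, let $\mathcal{P}^{(p)}:\mathbb{C}^{2\mathcal K}\to\mathbb{C}^{2\mathcal K}$, $\mathcal{P}^{(p)}(\mathbf{x})=(n_0,\dots,n_{2\mathcal K-1})$ with $n_k=\sum_{j=1}^{\mathcal K}a_jz_j^{pk}$, let $\mathcal{J}^{(p)}$ be its Jacobian matrix, and, where it is invertible, let $$\kappa^{(p)}_\alpha(\mathbf{x})=\sum_{i=1}^{2\mathcal K}\left|\left(\mathcal{J}^{(p)}(\mathbf{x})^{-1}\right)_{\alpha,i}\right||n_{i-1}|.$$ Separations: $\eta^{(j)}=\min_{r\ne j}|\arg z_j-\arg z_r|$, $\eta=\min_j\eta^{(j)}$, $\eta^*=\max_{r\ne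 j}|\arg z_j-\arg z_r|$, all angular differences being measured modulo $2\pi$ so that they lie in $[0,\pi]$. *)

(* Defs.v *)
From mathcomp Require Import all_boot all_order all_algebra.
From mathcomp Require Import all_classical all_reals all_analysis.
From mathcomp Require Import complex.

Set Implicit Arguments.
Unset Strict Implicit.
Unset Printing Implicit Defensive.

Import Order.TTheory GRing.Theory Num.Theory.
Import numFieldNormedType.Exports.

Local Open Scope ring_scope.

(* Coordinates are 0-based here: a_j sits at 2j and z_j at 2j+1, for
   j = 0, ..., K-1. *)
Lemma amp_index_subproof (K : nat) (j : 'I_K) : (j.*2 < K.*2)%N.
Proof. by rewrite ltn_double. Qed.

Lemma node_index_subproof (K : nat) (j : 'I_K) : (j.*2.+1 < K.*2)%N.
Proof. by rewrite ltn_Sdouble. Qed.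

Definition amp_index (K : nat) (j : 'I_K) : 'I_(K.*2) :=
  Ordinal (amp_index_subproof j).

Definition node_index (K : nat) (j : 'I_K) : 'I_(K.*2) :=
  Ordinal (node_index_subproof j).

Section PronyMap.
Variables (F : numFieldType) (K : nat).
Implicit Type x : 'rV[F]_(K.*2).

Definition amp x (j : 'I_K) : F := x ord0 (amp_index j).
Definition node x (j : 'I_K) : F := x ord0 (node_index j).

Definition prony_map (N : nat) x : 'rV[F]_N :=
  \row_(k < N) \sum_(j < K) amp x j * node x j ^+ k.

Definition decimated_prony_map (p : nat) x : 'rV[F]_(K.*2) :=
  \row_(k < K.*2) \sum_(j < K) amp x j * node x j ^+ (p * k).

(* The library's [jacobian] acts on row vectors: its (alpha, i) entry is the
   partial derivative of the i-th component along the alpha-th coordinate.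
   The usual Jacobian matrix is its transpose. *)
Definition prony_jacobian (N : nat) x : 'M[F]_(N, K.*2) :=
  (jacobian (prony_map N) x)^T.

Definition decimated_jacobian (p : nat) x : 'M[F]_(K.*2) :=
  (jacobian (decimated_prony_map p) x)^T.

End PronyMap.

Definition conj_transpose (C : numClosedFieldType) (m n : nat)
  (A : 'M[C]_(m, n)) : 'M[C]_(n, m) := map_mx Num.conj A^T.

Definition is_moore_penrose (C : numClosedFieldType) (m n : nat)
    (A : 'M[C]_(m, n)) (B : 'M[C]_(n, m)) : Prop :=
  [/\ A *m B *m A = A,
      B *m A *m B = B,
      conj_transpose (A *m B) = A *m B
    & conj_transpose (B *m A) = B *m A].

(* The four Penrose equations have exactly one solution, so the default value
   [0] is never used. *)
Definition moore_penrose (C : numClosedFieldType) (m n : nat)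
    (A : 'M[C]_(m, n)) : 'M[C]_(n, m) :=
  xget 0 [set B | is_moore_penrose A B]%classic.

Section ConditionNumbers.
Variables (R : realType) (K : nat).
Implicit Type x : 'rV[R[i]]_(K.*2).

(* The norm of [R[i]] takes its values in [R[i]]; this is the same modulus
   seen as an element of [R]. *)
Definition cmod (z : R[i]) : R := complex.Re `|z|.

Definition cond_number (N : nat) (alpha : 'I_(K.*2)) x : R :=
  \sum_(i < N) cmod (moore_penrose (prony_jacobian N x) alpha i)
               * cmod (prony_map N x ord0 i).

Definition decimated_cond_number (p : nat) (alpha : 'I_(K.*2)) x : R :=
  \sum_(i < K.*2) cmod (invmx (decimated_jacobian p x) alpha i)
                  * cmod (decimated_prony_map p x ord0 i).

Definition total_amp x : R := \sum_(m < K) cmod (amp x m).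

(* Principal argument, in (-pi, pi]; unique for z <> 0. *)
Definition carg (z : R[i]) : R :=
  xget 0 [set t : R | (- pi < t <= pi)%R /\
    z = Complex (cmod z * cos t) (cmod z * sin t)]%classic.

(* |arg z - arg w| modulo 2 pi, in [0, pi]. *)
Definition angle_dist (z w : R[i]) : R :=
  let d := `|carg z - carg w| in Num.min d (2 * pi - d).

(* Angular distances lie in [0, pi], so [pi] is neutral for the minima below
   and [0] for the maximum, as soon as 2 <= K. *)
Definition node_sep x (j : 'I_K) : R :=
  \big[Num.min/pi]_(r < K | r != j) angle_dist (node x j) (node x r).

Definition min_sep x : R := \big[Num.min/pi]_(j < K) node_sep x j.

Definition max_sep x : R :=
  \big[Num.max/0]_(j < K) \big[Num.max/0]_(r < K | r != j)
     angle_dist (node x j) (node x r).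

End ConditionNumbers.

(* Main.v *)
Require Import Defs.
From mathcomp Require Import all_boot all_order all_algebra.
From mathcomp Require Import all_classical all_reals all_analysis.
From mathcomp Require Import complex ring lra zify.

Set Implicit Arguments.
Unset Strict Implicit.
Unset Printing Implicit Defensive.

Import Order.TTheory GRing.Theory Num.Theory.
Import numFieldNormedType.Exports.

Local Open Scope ring_scope.

(** Why the theorem is true.

The [i]-th component of the Prony map is linear in the amplitudes and
polynomial in the nodes.  If [Q] is a polynomial of size at most [N] with
coefficients [Q_k], then pairing [Q_k] with the rows of the Jacobian gives
the values of [Q] at the nodes (columns of the amplitudes) and the values of
its derivative at the nodes, times [a_j] (columns of the nodes).  So the rows
of a left inverse of the Jacobian are the coefficient vectors of solutions of
Hermite interpolation problems; decimation by [p] replaces [z_j] by [z_j ^ p]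
and adds the factor [p z_j^(p-1)] of the chain rule.  Since [|m_k| <= sum |a_j|], bounding a condition number amounts to
bounding the sum of the moduli of the entries of one row.

A row of the inverse is a row of any left inverse, and a row of the
Moore-Penrose inverse is no longer, in Euclidean norm, than the corresponding
row of any left inverse [L].  By Cauchy-Schwarz, if the entries of that row of
[L] are at most [s] in modulus, then in both cases the sum of the moduli is at
most [N s] ([moore_penrose_row_sum_le]).  It remains to exhibit Hermite
polynomials with small coefficients.

For the node [w_j] on the unit circle, a length [T] and exponents [q_r <= T],
take

  G = (1/T) (sum_{k < T} (X / w_j)^k)
        * prod_{r <> j} ((X^q_r - w_r^q_r) / (w_j^q_r - w_r^q_r))^2 ,
  H = (X^T - w_j^T) / (T w_j^(T-1)) .

Then [G] has value 1 at [w_j] and double zeros at the other nodes, [H] has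
value 0 and derivative 1 at [w_j], so [H G] and [(1 - G'(w_j) H) G] solve the
two Hermite problems ([hermite_dual_pair]).  The first factor of [G] has
coefficients of modulus [1/T], and multiplication by a polynomial increases
the largest coefficient at most by the factor of the sum of its moduli, which
is [2 / |w_j^q_r - w_r^q_r|] for each binomial and [2 / T] for [H].

If the nodes are well separated, choose [T] of order [N] and [q_r] such that
[q_r] times the angle between [w_j] and [w_r] is of order 1; this is possible
with [q_r <= T] because [N eta] is large ([separating_power]).  All
denominators are then bounded below.  If the nodes form a cluster, decimate,
and take [T = q_r = 1], which gives the usual Hermite basis; the decimated
angles stay below [pi], so [|w_j - w_r|] is at least a constant times
[N eta_j], and since [N eta_j] is bounded above, missing powers of it may be
inserted. *)

(** * The Jacobian of power sums *)

Section Coordinates.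
Variable F : numFieldType.

Lemma diff_coord m n (M : 'M[F]_(m, n)) i j :
  'd (fun N : 'M[F]_(m, n) => N i j : F) M = (fun N => N i j) :> (_ -> _).
Proof.
have @f : {linear 'M[F]_(m, n) -> F}.
  by exists (fun N : 'M[F]_(_, _) => N i j); do 2![eexists]; do ?[constructor];
     rewrite ?mxE// => ? *; rewrite ?mxE//; move=> ?; rewrite !mxE.
rewrite (_ : (fun _ => _) = f) //; apply: diff_lin; exact: coord_continuous.
Qed.

Lemma is_derive_coord m n (M v : 'M[F]_(m, n)) i j :
  is_derive M v (fun N : 'M[F]_(m, n) => N i j : F) (v i j).
Proof.
apply: DeriveDef; first exact/diff_derivable/differentiable_coord.
by rewrite deriveE ?diff_coord //; exact: differentiable_coord.
Qed.

Lemma jacobian_entry m n (f : 'rV[F]_m -> 'rV[F]_n) x a k :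
  differentiable f x ->
  jacobian f x a k = 'D_(delta_mx 0 a) (fun y => f y 0 k : F) x.
Proof.
move=> df; have dc := differentiable_coord (f x) 0 k.
rewrite (_ : (fun y => f y 0 k) = (fun N : 'rV[F]_n => N 0 k : F) \o f) //.
rewrite deriveE; last exact: differentiable_comp.
by rewrite diff_comp // diff_coord /= mxE.
Qed.

End Coordinates.

Section PowerSums.
Variables (F : numFieldType) (K : nat).
Implicit Type x : 'rV[F]_(K.*2).

(** The Prony map is the case [p = 1]; the decimated one is [n = K.*2]. *)
Definition power_sums p n x : 'rV[F]_n :=
  \row_(k < n) \sum_(j < K) amp x j * node x j ^+ (p * k).

Lemma prony_mapE N : @prony_map F K N = power_sums 1 N.
Proof.
apply/funext => x; apply/rowP => k; rewrite !mxE.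
by apply: eq_bigr => j _; rewrite mul1n.
Qed.

Lemma decimated_prony_mapE p : @decimated_prony_map F K p = power_sums p K.*2.
Proof. by []. Qed.

Lemma differentiable_power_sum (e : nat) x :
  differentiable (\sum_(j < K) (fun y => amp y j * node y j ^+ e) : _ -> F) x.
Proof.
apply: differentiable_sum => j.
have -> : (fun y : 'rV[F]_(K.*2) => amp y j * node y j ^+ e)
          = (fun y => amp y j) * (fun y => node y j) ^+ e.
  by apply/funext => y /=; rewrite exprfctE.
apply: differentiableM; first exact: differentiable_coord.
case: e => [|e]; first by rewrite expr0; apply: differentiable_cst.
by apply: differentiableX; exact: differentiable_coord.
Qed.

Lemma power_sumsE p n : power_sums p n = fun x => \row_(k < n)
  (\sum_(j < K) (fun y => amp y j * node y j ^+ (p * k)) : _ -> F) x.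
Proof.
by apply/funext => x; apply/rowP => k; rewrite !mxE fct_sumE.
Qed.

Lemma differentiable_power_sums p n x : differentiable (power_sums p n) x.
Proof.
have -> : power_sums p n = \sum_(k < n) (fun y =>
    (\sum_(j < K) (fun y => amp y j * node y j ^+ (p * k)) : _ -> F) y
    *: delta_mx 0 k).
  rewrite power_sumsE; apply/funext => y; rewrite fct_sumE.
  by rewrite [LHS]row_sum_delta; apply: eq_bigr => k _; rewrite !mxE.
apply: differentiable_sum => k; apply: differentiableZl.
exact: differentiable_power_sum.
Qed.

Lemma amp_delta (a : 'I_(K.*2)) j :
  amp (delta_mx 0 a : 'rV[F]_(K.*2)) j = (amp_index j == a)%:R.
Proof. by rewrite /amp mxE eqxx. Qed.

Lemma node_delta (a : 'I_(K.*2)) j :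
  node (delta_mx 0 a : 'rV[F]_(K.*2)) j = (node_index j == a)%:R.
Proof. by rewrite /node mxE eqxx. Qed.

Lemma jacobian_power_sums p n x a k :
  jacobian (power_sums p n) x a k =
  \sum_(j < K) ((amp_index j == a)%:R * node x j ^+ (p * k)
    + amp x j * ((node_index j == a)%:R *
         ((p * k)%:R * node x j ^+ (p * k).-1))).
Proof.
rewrite (jacobian_entry _ _ (differentiable_power_sums p n x)).
set v : 'rV[F]_(K.*2) := delta_mx 0 a.
have -> : (fun y => power_sums p n y 0 k) =
   \sum_(j < K) ((fun y => amp y j) * (fun y => node y j) ^+ (p * k)) :> (_ -> F).
  apply/funext => y; rewrite mxE fct_sumE; apply: eq_bigr => j _.
  by rewrite [in RHS]exprfctE.
have dc (b : 'I_(K.*2)) : is_derive x v (fun y : 'rV[F]_(K.*2) => y 0 b) (v 0 b).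
  exact: is_derive_coord.
rewrite derive_sum; last first.
  move=> j; apply: derivableM; last apply: derivableX.
    exact: (@ex_derive _ _ _ _ _ _ _ (dc _)).
  exact: (@ex_derive _ _ _ _ _ _ _ (dc _)).
apply: eq_bigr => j _.
have Ha : is_derive x v (fun y : 'rV[F]_(K.*2) => amp y j) (amp v j) by exact: dc.
have Hn : is_derive x v (fun y : 'rV[F]_(K.*2) => node y j) (node v j) by exact: dc.
rewrite (@derive_val _ _ _ _ _ _ _ (is_deriveM Ha (is_deriveX (p * k) Hn))).
rewrite amp_delta node_delta /GRing.scale /= exprfctE addrC.
by congr (_ + _); rewrite mulrC // [_%:R * _ in RHS]mulrC mulrC.
Qed.

Lemma amp_index_inj : injective (@amp_index K).
Proof. by move=> i j /(congr1 val) /double_inj /val_inj. Qed.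

Lemma node_index_inj : injective (@node_index K).
Proof. by move=> i j /(congr1 val) /= [] /double_inj /val_inj. Qed.

Lemma amp_node_index i j : (amp_index i == node_index j :> 'I_(K.*2)) = false.
Proof.
apply/negP => /eqP /(congr1 (fun i : 'I__ => odd i)) /=.
by rewrite !odd_double.
Qed.

Lemma jacobian_amp p n x j k :
  jacobian (power_sums p n) x (amp_index j) k = node x j ^+ (p * k).
Proof.
rewrite jacobian_power_sums (bigD1 j) //= eqxx mul1r eq_sym amp_node_index.
rewrite mul0r mulr0 addr0 big1 ?addr0 // => i ij.
rewrite (inj_eq amp_index_inj) (negPf ij) mul0r.
by rewrite eq_sym amp_node_index mul0r mulr0 addr0.
Qed.

Lemma jacobian_node p n x j k :
  jacobian (power_sums p n) x (node_index j) k =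
  amp x j * ((p * k)%:R * node x j ^+ (p * k).-1).
Proof.
rewrite jacobian_power_sums (bigD1 j) //= eqxx mul1r amp_node_index.
rewrite mul0r add0r big1 ?addr0 // => i ij.
rewrite (inj_eq node_index_inj) (negPf ij) amp_node_index.
by rewrite !mul0r mulr0 addr0.
Qed.

(** Pairing the coefficients of a polynomial with a column of the Jacobian
    evaluates the polynomial, or its derivative, at a power of a node: this is
    what turns left inverses into Hermite interpolation. *)
Lemma coef_jacobian_amp p n x j (Q : {poly F}) : (size Q <= n)%N ->
  \sum_(k < n) Q`_k * jacobian (power_sums p n) x (amp_index j) k
  = Q.[node x j ^+ p].
Proof.
move=> /horner_coef_wide ->; apply: eq_bigr => k _.
by rewrite jacobian_amp exprM.
Qed.

Lemma coef_jacobian_node p n x j (Q : {poly F}) : (size Q <= n)%N ->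
  \sum_(k < n) Q`_k * jacobian (power_sums p n) x (node_index j) k
  = amp x j * (p%:R * node x j ^+ p.-1) * Q^`().[node x j ^+ p].
Proof.
move=> sQ; have sQ' : (size Q^`() <= n.-1)%N.
  have [->|Q0] := eqVneq Q 0; first by rewrite deriv0 size_poly0.
  by rewrite -ltnS (leq_trans (lt_size_deriv Q0)) // (leq_trans sQ) ?leqSpred.
rewrite (horner_coef_wide _ sQ') mulr_sumr.
case: n sQ sQ' => [|n] sQ sQ' /=; first by rewrite !big_ord0.
(* the constant coefficient does not contribute, which shifts the index *)
rewrite big_ord_recl jacobian_node muln0 mul0r mulr0 mulr0 add0r.
apply: eq_bigr => k _; rewrite jacobian_node coef_deriv lift0.
have [->|p0] := posnP p; first by rewrite !mul0n !mul0r !mulr0 mul0r.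
have -> : (p * k.+1).-1 = (p.-1 + p * k)%N by rewrite mulnS -subn1 -addnBAC // subn1.
rewrite exprD exprM natrM -mulr_natr; ring.
Qed.

End PowerSums.

(** * Rows of the Moore-Penrose inverse *)

Section MoorePenrose.
Variable C : numClosedFieldType.

Lemma conj_transpose_mul m n p (A : 'M[C]_(m, n)) (B : 'M[C]_(n, p)) :
  conj_transpose (A *m B) = conj_transpose B *m conj_transpose A.
Proof. by rewrite /conj_transpose trmx_mul map_mxM. Qed.

Lemma conj_transposeK m n (A : 'M[C]_(m, n)) :
  conj_transpose (conj_transpose A) = A.
Proof. by apply/matrixP => i j; rewrite !mxE conjCK. Qed.

Lemma mul_conj_transpose_diag m n (A : 'M[C]_(m, n)) i :
  (A *m conj_transpose A) i i = \sum_k `|A i k| ^+ 2.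
Proof. by rewrite mxE; apply: eq_bigr => k _; rewrite !mxE normCK. Qed.

Lemma mul_conj_transpose_eq0 m n (A : 'M[C]_(m, n)) :
  A *m conj_transpose A = 0 -> A = 0.
Proof.
move=> A0; apply/matrixP => i k; rewrite mxE.
have /eqP : (A *m conj_transpose A) i i = 0 by rewrite A0 mxE.
rewrite mul_conj_transpose_diag psumr_eq0; last by move=> *; exact: exprn_ge0.
by move=> /allP /(_ k (mem_index_enum _)) /=; rewrite sqrf_eq0 normr_eq0 => /eqP.
Qed.

(** If [v A^* A = 0] then [v A^*] has norm zero, and [A^*] is cancelled on the
    right by the adjoint of the left inverse. *)
Lemma gram_unitmx m n (A : 'M[C]_(m, n)) (L : 'M[C]_(n, m)) :
  L *m A = 1%:M -> conj_transpose A *m A \in unitmx.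
Proof.
move=> LA; rewrite -row_free_unit -kermx_eq0; apply/rowV0P => v.
move=> /sub_kermxP vG.
have /mul_conj_transpose_eq0 vA : (v *m conj_transpose A)
    *m conj_transpose (v *m conj_transpose A) = 0.
  by rewrite conj_transpose_mul conj_transposeK !mulmxA -(mulmxA v) vG mul0mx.
rewrite -[v]mulmx1 -(_ : conj_transpose A *m conj_transpose L = 1%:M).
  by rewrite mulmxA vA mul0mx.
rewrite -conj_transpose_mul LA; apply/matrixP => i j.
by rewrite !mxE eq_sym conjC_nat.
Qed.

(** For full column rank, [(A^* A)^-1 A^*] satisfies the four Penrose
    equations. *)
Lemma moore_penroseP m n (A : 'M[C]_(m, n)) (L : 'M[C]_(n, m)) :
  L *m A = 1%:M -> is_moore_penrose A (moore_penrose A).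
Proof.
move=> LA; have G_unit := gram_unitmx LA.
set G := conj_transpose A *m A in G_unit.
have GH : conj_transpose G = G by rewrite conj_transpose_mul conj_transposeK.
have GVH : conj_transpose (invmx G) = invmx G.
  rewrite /conj_transpose trmx_inv map_invmx.
  by rewrite -[map_mx _ G^T]/(conj_transpose G) GH.
apply: (@xgetPex _ 0 [set B | is_moore_penrose A B]%classic).
exists (invmx G *m conj_transpose A) => /=.
have BA : invmx G *m conj_transpose A *m A = 1%:M by rewrite -mulmxA mulVmx.
split.
- by rewrite -mulmxA BA mulmx1.
- by rewrite BA mul1mx.
- by rewrite !conj_transpose_mul conj_transposeK GVH mulmxA.
- by rewrite BA; apply/matrixP => i j; rewrite !mxE eq_sym conjC_nat.
Qed.

(** With [B] the Moore-Penrose inverse, [P = A B] is an orthogonal projection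
    and [B = (L A) B = L P], so each row of [B] is the projection of the
    corresponding row of [L]; Pythagoras gives the inequality. *)
Lemma moore_penrose_row_le m n (A : 'M[C]_(m, n)) (L : 'M[C]_(n, m)) a :
  L *m A = 1%:M ->
  \sum_k `|moore_penrose A a k| ^+ 2 <= \sum_k `|L a k| ^+ 2.
Proof.
move=> LA; have [_ BAB PH _] := moore_penroseP LA.
set B := moore_penrose A in BAB PH *; set P := A *m B in PH.
have PP : P *m P = P by rewrite /P -mulmxA (mulmxA B) BAB.
have BLP : B = L *m P by rewrite /P mulmxA LA mul1mx.
clearbody P; have pyth : L *m conj_transpose L = B *m conj_transpose B
    + (L - B) *m conj_transpose (L - B).
  have LP : L - B = L *m (1%:M - P) by rewrite BLP mulmxBr mulmx1.
  rewrite LP BLP !conj_transpose_mul PH.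
  have -> : conj_transpose (1%:M - P) = 1%:M - P.
    rewrite /conj_transpose linearB /= map_mxB trmx1 map_mx1.
    by rewrite -[map_mx _ P^T]/(conj_transpose P) PH.
  have QQ : (1%:M - P) *m (1%:M - P) = 1%:M - P.
    by rewrite mulmxBl mul1mx mulmxBr mulmx1 PP subrr subr0.
  rewrite !mulmxA -(mulmxA L P P) PP -(mulmxA L (1%:M - P)) QQ.
  by rewrite -mulmxDl -mulmxDr addrC subrK mulmx1.
rewrite -!mul_conj_transpose_diag pyth [leRHS]mxE lerDl mul_conj_transpose_diag.
by apply: sumr_ge0 => k _; exact: exprn_ge0.
Qed.

End MoorePenrose.

Section Modulus.
Variable R : realType.
Implicit Types z w : R[i].

(** [cmod] lives in the real field, where order is total; this equation
    transfers to it the properties of the norm of [R[i]]. *)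
Lemma norm_cmodE z : `|z| = (cmod z)%:C%C.
Proof. by case: z. Qed.

Lemma cmod_ge0 z : 0 <= cmod z.
Proof. rewrite -lecR -norm_cmodE; exact: normr_ge0. Qed.

Lemma cmodD z w : cmod (z + w) <= cmod z + cmod w.
Proof. by rewrite -lecR rmorphD /= -!norm_cmodE ler_normD. Qed.

Lemma cmod_inj z w : `|z| = `|w| -> cmod z = cmod w.
Proof. by rewrite /cmod => ->. Qed.

Lemma cmodM z w : cmod (z * w) = cmod z * cmod w.
Proof. by apply: complexI; rewrite rmorphM /= -!norm_cmodE normrM. Qed.

Lemma cmodX z n : cmod (z ^+ n) = cmod z ^+ n.
Proof. by apply: complexI; rewrite rmorphXn /= -!norm_cmodE normrX. Qed.

Lemma cmodV z : cmod z^-1 = (cmod z)^-1.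
Proof. by apply: complexI; rewrite fmorphV /= -!norm_cmodE normfV. Qed.

Lemma cmodN z : cmod (- z) = cmod z.
Proof. by apply: cmod_inj; rewrite normrN. Qed.

Lemma cmod_nat n : cmod (n%:R : R[i]) = n%:R.
Proof. by apply: complexI; rewrite rmorph_nat -!norm_cmodE normr_nat. Qed.

Lemma cmod0 : cmod (0 : R[i]) = 0. Proof. exact: (cmod_nat 0). Qed.

Lemma cmod_eq0 z : (cmod z == 0) = (z == 0).
Proof. by rewrite -(inj_eq (@complexI R)) -norm_cmodE normr_eq0. Qed.

Lemma cmod_gt0 z : (0 < cmod z) = (z != 0).
Proof. by rewrite lt_def cmod_ge0 cmod_eq0 andbT. Qed.

Lemma cmod_sum (I : Type) (r : seq I) (P : pred I) (f : I -> R[i]) :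
  cmod (\sum_(i <- r | P i) f i) <= \sum_(i <- r | P i) cmod (f i).
Proof.
elim/big_ind2: _ => [|z a w b za wb|//]; first by rewrite cmod0.
by apply: le_trans (cmodD _ _) _; exact: lerD.
Qed.

(** Going from a bound on entries to a Euclidean norm and back to a sum of
    moduli costs [sqrt m] twice, so nothing is lost when the entries of the row
    of [L] have comparable moduli. *)
Lemma moore_penrose_row_sum_le m n (A : 'M[R[i]]_(m, n))
    (L : 'M[R[i]]_(n, m)) a s :
  L *m A = 1%:M -> 0 < s -> (forall k, cmod (L a k) <= s) ->
  \sum_k cmod (moore_penrose A a k) <= m%:R * s.
Proof.
move=> LA s0 Ls; set B := moore_penrose A.
have B2 : \sum_k cmod (B a k) ^+ 2 <= m%:R * s ^+ 2.
  apply: (@le_trans _ _ (\sum_k cmod (L a k) ^+ 2)); last first.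
    rewrite -[m in m%:R]card_ord mulr_natl -sumr_const.
    by apply: ler_sum => k _; rewrite lerXn2r ?nnegrE ?cmod_ge0 ?Ls ?ltW.
  rewrite -lecR !rmorph_sum /=.
  under eq_bigr do rewrite rmorphXn /= -norm_cmodE.
  under [leRHS]eq_bigr do rewrite rmorphXn /= -norm_cmodE.
  exact: moore_penrose_row_le.
rewrite -(ler_pM2l (mulr_gt0 (ltr0n _ 2) s0)) mulr_sumr.
apply: (@le_trans _ _ (\sum_(k < m) (s ^+ 2 + cmod (B a k) ^+ 2))).
  (* [2 s b <= s^2 + b^2] replaces Cauchy-Schwarz *)
  apply: ler_sum => k _; have := sqr_ge0 (s - cmod (B a k)); lra.
rewrite big_split /= sumr_const card_ord -mulr_natl.
lra.
Qed.

End Modulus.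

(** * Powers on the unit circle *)

Section UnitCircle.
Variable R : realType.
Implicit Types (z w : R[i]) (t a b : R).

Definition expi t : R[i] := Complex (cos t) (sin t).

Lemma expiX t n : expi t ^+ n = expi (n%:R * t).
Proof.
elim: n => [|n IH]; first by rewrite expr0 mul0r /expi cos0 sin0.
rewrite exprS IH -natr1 mulrDl mul1r addrC /expi cosD sinD.
by apply/eqP; rewrite eq_complex /= -!/(_ * _); apply/andP; split; apply/eqP; ring.
Qed.

Lemma sqr_cmodE z : cmod z ^+ 2 = complex.Re z ^+ 2 + complex.Im z ^+ 2.
Proof. by case: z => a b; rewrite sqr_sqrtr ?addr_ge0 ?sqr_ge0. Qed.

Lemma cmod_expiB a b : cmod (expi a - expi b) ^+ 2 = 2 - 2 * cos (a - b).
Proof.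
rewrite sqr_cmodE /= cosB.
have := cos2Dsin2 a; have := cos2Dsin2 b; lra.
Qed.

(** By the mean value theorem [sin t = t * cos y] with [y <= t], and the cosine
    decreases. *)
Lemma mul_cos_le_sin t : 0 <= t <= pi -> t * cos t <= sin t.
Proof.
case/andP=> t0 tpi.
have d x : x \in `]0, t[ -> is_derive x 1 sin (cos x).
  by move=> _; exact: is_derive_sin.
have c : {within `[0, t], continuous (@sin R)}%classic.
  exact/continuous_subspaceT/continuous_sin.
have [y] := MVT_segment t0 d c.
rewrite in_itv /= sin0 !subr0 => /andP[y0 yt] ->.
rewrite mulrC ler_wpM2r // leNgt ltr_cos ?in_itv /= ?t0 ?y0 ?tpi //.
  by rewrite -leNgt.
exact: le_trans yt tpi.
Qed.

(** The left side is a quarter of the squared angle, and [2 - 2 * cos t] the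
    squared length of its chord [2 * sin (t / 2)].  With [u = t / 4 <= pi / 4],
    [sin (2 u) = 2 * sin u * cos u >= 2 * u * cos u ^+ 2 >= u], because
    [cos u ^+ 2 >= 1 / 2]. *)
Lemma chord_ge t : 0 <= t <= pi -> (t / 2) ^+ 2 <= 2 - 2 * cos t.
Proof.
case/andP=> t0 tpi; have p0 := @pi_gt0 R.
pose u := t / 4; have u0 : 0 <= u by rewrite divr_ge0.
have c2u := cos_mulr2n u.
have c2u_ge0 : 0 <= cos (u *+ 2).
  by apply: cos_ge0_pihalf; rewrite [u *+ 2]mulr2n /u; apply/andP; split; lra.
have su : u * cos u <= sin u.
  by apply: mul_cos_le_sin; rewrite u0 /= /u; lra.
have cu : 0 <= cos u.
  by apply: cos_ge0_pihalf; rewrite /u; apply/andP; split; lra.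
have s2u : u <= sin (u *+ 2).
  rewrite sin_mulr2n; apply: le_trans (_ : (cos u * (u * cos u)) *+ 2 <= _).
    rewrite mulrCA -expr2 -mulr_natr -mulrA ler_peMr //.
    by rewrite mulr_natr -subr_ge0 -c2u.
  by rewrite lerMn2r ler_wpM2l.
have -> : cos t = 1 - 2 * sin (u *+ 2) ^+ 2.
  have -> : t = u *+ 2 *+ 2 by rewrite !mulr2n /u; field.
  rewrite cos_mulr2n cos2sin2 [_ *+ 2 in LHS]mulr2n; ring.
have -> : t / 2 = 2 * u by rewrite /u; field.
have : u ^+ 2 <= sin (u *+ 2) ^+ 2 by rewrite lerXn2r ?nnegrE // (le_trans u0).
clearbody u; rewrite exprMn; lra.
Qed.

Lemma cargP z : cmod z = 1 ->
  (- pi < carg z <= pi) /\ z = expi (carg z).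
Proof.
move=> z1.
suff : [set t : R | (- pi < t <= pi)%R /\
    z = Complex (cmod z * cos t) (cmod z * sin t)]%classic (carg z).
  by case=> tb zE; split=> //; rewrite {1}zE z1 !mul1r.
apply: xgetPex; rewrite /= z1.
have := sqr_cmodE z; rewrite z1 expr1n; case: z z1 => a b _ /= ab.
have a1 : -1 <= a <= 1.
  by rewrite -ler_norml -(@ler_pXn2r _ 2) ?nnegrE // real_normK ?num_real //
    expr1n ab lerDl sqr_ge0.
have sE : sin (acos a) = `|b|.
  by rewrite sin_acos // ab addrC addKr sqrtr_sqr.
have [b0|b0] := leP 0 b.
  exists (acos a); rewrite !mul1r acosK ?in_itv // sE ger0_norm //; split=> //.
  rewrite acos_lepi // andbT (lt_le_trans _ (acos_ge0 a1)) //.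
  by rewrite oppr_lt0 pi_gt0.
exists (- acos a); rewrite !mul1r cosN sinN acosK ?in_itv // sE ltr0_norm // opprK;
  split=> //.
have aN1 : -1 < a.
  case/andP: a1; rewrite le_eqVlt => /orP[/eqP aE _|//].
  have /eqP : b ^+ 2 = 0 by move: ab; rewrite -aE; lra.
  by rewrite sqrf_eq0 => /eqP b_eq0; move: b0; rewrite b_eq0 ltxx.
rewrite ltrN2 acos_ltpi ?aN1 ?(andP a1).2 //=.
by rewrite (le_trans _ (@pi_ge0 R)) // oppr_le0 acos_ge0.
Qed.

(** The angular distance is the difference of the arguments up to sign and a
    multiple of [2 * pi], which integer multiples preserve. *)
Lemma cos_angle_dist n z w : cos (n%:R * angle_dist z w)
  = cos (n%:R * (carg z - carg w)).
Proof.
have cosM d : cos (n%:R * (2 * pi - d)) = cos (n%:R * d) :> R.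
  rewrite mulrBr -cosN opprB -[n%:R * (2 * pi)](_ : pi *+ 2 *+ n = _).
    by rewrite -(periodicn (@cosD2pi R) n) subrK.
  by rewrite -[LHS]mulr_natl -[pi *+ 2]mulr_natl.
have cosn d : cos (n%:R * `|d|) = cos (n%:R * d) :> R.
  by rewrite -[in RHS]cos_norm normrM normr_nat.
by rewrite /angle_dist /Num.min; case: ifP => _; rewrite ?cosM cosn.
Qed.

Lemma angle_dist_ge0 z w : cmod z = 1 -> cmod w = 1 -> 0 <= angle_dist z w.
Proof.
move=> /cargP [/andP[z1 z2] _] /cargP [/andP[w1 w2] _].
rewrite le_min normr_ge0 subr_ge0 ler_norml; apply/andP; split; lra.
Qed.

Lemma angle_dist_gt0 z w :
  cmod z = 1 -> cmod w = 1 -> z <> w -> 0 < angle_dist z w.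
Proof.
move=> /cargP [/andP[z1 z2] zE] /cargP [/andP[w1 w2] wE] zw.
rewrite lt_min normr_gt0 subr_eq0 subr_gt0 ltr_norml.
have -> /= : carg z != carg w by apply/eqP => e; apply: zw; rewrite zE e.
by apply/andP; split; lra.
Qed.

Lemma angle_dist_le_pi z w : angle_dist z w <= pi.
Proof. rewrite ge_min; have := @pi_ge2 R; case: leP => //= h; lra. Qed.

(** As long as the [n]-th powers have not moved apart by more than a half turn,
    their distance is comparable to [n] times the angle. *)
Lemma power_chord_ge n z w : cmod z = 1 -> cmod w = 1 ->
  n%:R * angle_dist z w <= pi ->
  n%:R * angle_dist z w / 2 <= cmod (z ^+ n - w ^+ n).
Proof.
move=> z1 w1 npi; have n0 : 0 <= n%:R * angle_dist z w.
  by rewrite mulr_ge0 // angle_dist_ge0.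
rewrite -(@ler_pXn2r _ 2) ?nnegrE ?cmod_ge0 ?divr_ge0 //.
rewrite (cargP z1).2 (cargP w1).2 !expiX cmod_expiB -mulrBr.
rewrite -(cargP z1).2 -(cargP w1).2 -cos_angle_dist.
by apply: chord_ge; rewrite n0.
Qed.

End UnitCircle.

(** * Hermite interpolation with small coefficients *)

Section CoefficientBounds.
Variable R : realType.
Implicit Types (f g h : {poly R[i]}) (s c d : R).

Definition coef_bound f s := forall i, cmod f`_i <= s.

(** Bounds the norm of multiplication by [g] for the largest coefficient; the
    best [c] is the sum of the moduli of the coefficients of [g].  In this form
    products and sums of bounds are immediate. *)
Definition multiplier_bound g c :=
  forall f s, coef_bound f s -> coef_bound (f * g) (s * c).

Lemma coef_bound_ge0 f s : coef_bound f s -> 0 <= s.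
Proof. by move=> /(_ 0%N); apply: le_trans; exact: cmod_ge0. Qed.

Lemma multiplier_bound_le g c d :
  c <= d -> multiplier_bound g c -> multiplier_bound g d.
Proof.
move=> cd gc f s fs i; apply: le_trans (gc f s fs i) _.
by rewrite ler_wpM2l // (coef_bound_ge0 fs).
Qed.

Lemma multiplier_boundC (a : R[i]) : multiplier_bound a%:P (cmod a).
Proof.
move=> f s fs i; rewrite coefMC cmodM ler_wpM2r ?cmod_ge0 //; exact: fs.
Qed.

Lemma multiplier_boundXn n : multiplier_bound 'X^n 1.
Proof.
move=> f s fs i; rewrite mulr1 coefMXn; case: ifP => _; last exact: fs.
by rewrite cmod0 (coef_bound_ge0 fs).
Qed.

Lemma multiplier_boundM g h c d : multiplier_bound g c ->
  multiplier_bound h d -> multiplier_bound (g * h) (c * d).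
Proof. by move=> gc hd f s fs; rewrite !mulrA; apply/hd/gc. Qed.

Lemma multiplier_boundD g h c d : multiplier_bound g c ->
  multiplier_bound h d -> multiplier_bound (g + h) (c + d).
Proof.
move=> gc hd f s fs i; rewrite !mulrDr coefD.
by apply: le_trans (cmodD _ _) _; apply: lerD; [exact: gc|exact: hd].
Qed.

Lemma multiplier_boundN g c :
  multiplier_bound g c -> multiplier_bound (- g) c.
Proof. by move=> gc f s fs i; rewrite mulrN coefN cmodN; exact: gc. Qed.

Lemma multiplier_bound1 : multiplier_bound 1 1.
Proof. by rewrite -(expr0 'X); exact: multiplier_boundXn. Qed.

Lemma multiplier_bound_prod (I : finType) (P : pred I) (g : I -> {poly R[i]})
    (c : I -> R) : (forall r, P r -> multiplier_bound (g r) (c r)) ->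
  multiplier_bound (\prod_(r | P r) g r) (\prod_(r | P r) c r).
Proof.
move=> gc; elim/big_ind2: _ => //; first exact: multiplier_bound1.
by move=> ? ? ? ?; exact: multiplier_boundM.
Qed.

End CoefficientBounds.

(** The logarithmic derivative at a point where all factors equal 1.  Bounding
    [G'] through it, and not through the coefficients of [G], costs only one
    power of the inverse distances between nodes. *)
Lemma deriv_prod_at (F : comNzRingType) (I : Type) (r : seq I) (P : pred I)
    (g : I -> {poly F}) w : (forall i, P i -> (g i).[w] = 1) ->
  (\prod_(i <- r | P i) g i)^`().[w] = \sum_(i <- r | P i) (g i)^`().[w].
Proof.
move=> g1; elim: r => [|i r IH]; first by rewrite !big_nil -polyC1 derivC horner0.
rewrite !big_cons; case: ifP => // Pi; rewrite derivM hornerD !hornerM IH g1 //.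
rewrite horner_prod big1 ?mulr1 ?mul1r // => k; exact: g1.
Qed.

Section Kernels.
Variable R : realType.
Implicit Types (w v : R[i]) (q T : nat).

Definition power_binomial q (a v : R[i]) : {poly R[i]} :=
  a *: ('X^q - (v ^+ q)%:P).

Lemma size_power_binomial q a v : (size (power_binomial q a v) <= q.+1)%N.
Proof.
apply: leq_trans (size_scale_leq _ _) _; apply: leq_trans (size_polyD _ _) _.
by rewrite size_polyXn size_polyN geq_max leqnn (leq_trans (size_polyC_leq1 _)).
Qed.

Lemma power_binomialE q a v w :
  (power_binomial q a v).[w] = a * (w ^+ q - v ^+ q).
Proof. by rewrite !hornerE. Qed.

Lemma deriv_power_binomialE q a v w :
  (power_binomial q a v)^`().[w] = a * (q%:R * w ^+ q.-1).
Proof.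
by rewrite derivZ derivB derivC subr0 derivXn hornerZ hornerMn hornerXn mulr_natl.
Qed.

Lemma multiplier_power_binomial q a v : cmod v = 1 ->
  multiplier_bound (power_binomial q a v) (2 * cmod a).
Proof.
move=> v1; rewrite /power_binomial -mul_polyC mulrC.
apply: multiplier_boundM; last exact: multiplier_boundC.
apply: multiplier_boundD; first exact: multiplier_boundXn.
apply: multiplier_boundN; rewrite -[1](_ : cmod (v ^+ q) = 1).
  exact: multiplier_boundC.
by rewrite cmodX v1 expr1n.
Qed.

(** A normalised Dirichlet kernel, [(1 / T) * sum_(k < T) (X / w)^k]: its value
    at [w] is 1, although its coefficients have modulus [1 / T]. *)
Definition averaging_kernel T w : {poly R[i]} :=
  \poly_(k < T) (T%:R^-1 * w ^- k).

Lemma coef_averaging_kernel T w : cmod w = 1 ->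
  coef_bound (averaging_kernel T w) T%:R^-1.
Proof.
move=> w1 k; rewrite coef_poly; case: ifP => _; last by rewrite cmod0 invr_ge0.
by rewrite cmodM !cmodV cmod_nat cmodX w1 expr1n invr1 mulr1.
Qed.

Lemma averaging_kernel_at T w : (0 < T)%N -> cmod w = 1 ->
  (averaging_kernel T w).[w] = 1.
Proof.
move=> T0 w1; have w0 : w != 0 by rewrite -cmod_gt0 w1.
rewrite horner_poly (eq_bigr (fun=> T%:R^-1)) => [|k _]; last first.
  by rewrite mulfVK // expf_neq0.
by rewrite sumr_const card_ord -[LHS]mulr_natr mulVf // pnatr_eq0 -lt0n.
Qed.

Lemma cmod_deriv_averaging_kernel T w : (0 < T)%N -> cmod w = 1 ->
  cmod (averaging_kernel T w)^`().[w] <= T%:R.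
Proof.
move=> T0 w1; rewrite /averaging_kernel poly_def raddf_sum /= horner_sum.
apply: le_trans (cmod_sum _ _ _) _.
apply: (@le_trans _ _ (\sum_(k < T) 1)); last by rewrite sumr_const card_ord.
apply: ler_sum => k _; rewrite derivZ derivXn hornerZ hornerMn hornerXn.
rewrite -[_ ^+ _ *+ _]mulr_natl !cmodM !cmodV !cmodX w1 !expr1n !cmod_nat.
rewrite invr1 !mulr1.
by rewrite mulrC ler_pdivrMr ?ltr0n // mul1r ler_nat ltnW.
Qed.

(** Bounds the coefficients of the polynomial [G] of [hermite_dual_pair]: [1 / T]
    comes from the averaging kernel, and two factors [2 / D] from each other
    node. *)
Definition kernel_bound (K T : nat) (D : R) : R :=
  T%:R^-1 * ((2 / D) ^+ 2) ^+ K.-1.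

(** [P] and [Q] are dual to the value and to the derivative at [w j].  With [G]
    and [H] as in the introduction, [Q = H * G] and [P = (1 - G'(w j) * H) * G].  The
    exponents [q r] are free because [w j ^+ q r] and [w r ^+ q r] may be far
    apart even if [w j] and [w r] are close. *)
Lemma hermite_dual_pair K (w : 'I_K -> R[i]) (j : 'I_K) T (q : 'I_K -> nat)
    (D : R) :
  (0 < T)%N -> 0 < D -> (forall r, cmod (w r) = 1) ->
  (forall r, r != j -> (q r <= T)%N) ->
  (forall r, r != j -> D <= cmod (w j ^+ q r - w r ^+ q r)) ->
  exists P Q : {poly R[i]}, [/\
    (size P <= K.*2 * T)%N /\ (size Q <= K.*2 * T)%N,
    forall r, P.[w r] = (r == j)%:R /\ P^`().[w r] = 0,
    forall r, Q.[w r] = 0 /\ Q^`().[w r] = (r == j)%:R,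
    coef_bound P (kernel_bound K T D * (3 + 4 * K%:R / D)) &
    coef_bound Q (kernel_bound K T D * (2 / T%:R))].
Proof.
move=> T0 D0 w1 qT wD.
have w0 : w j != 0 by rewrite -cmod_gt0 w1.
have TR0 : (0 : R) < T%:R by rewrite ltr0n.
have K0 : (0 < K)%N by apply: leq_ltn_trans (ltn_ord j).
pose d r := w j ^+ q r - w r ^+ q r.
have d0 r : r != j -> d r != 0.
  by move=> /wD; rewrite -cmod_gt0; apply: lt_le_trans.
pose b r := power_binomial (q r) (d r)^-1 (w r).
have b1 r : r != j -> (b r).[w j] = 1.
  by move=> rj; rewrite power_binomialE mulVf // d0.
pose B := \prod_(r | r != j) b r ^+ 2.
pose A := averaging_kernel T (w j).
pose G := A * B.
pose H := power_binomial T (T%:R * w j ^+ T.-1)^-1 (w j).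
have B1 : B.[w j] = 1.
  rewrite horner_prod big1 // => r /b1 br.
  by rewrite expr2 hornerM br mulr1.
have G1 : G.[w j] = 1 by rewrite hornerM averaging_kernel_at // mul1r.
have H0 : H.[w j] = 0 by rewrite power_binomialE subrr mulr0.
have H1 : H^`().[w j] = 1.
  rewrite deriv_power_binomialE mulVf // mulf_neq0 ?expf_neq0 //.
  by rewrite pnatr_eq0 -lt0n.
have Gr r : r != j -> exists G', G = G' * ('X - (w r)%:P) ^+ 2.
  move=> rj; have /factor_theorem [b' bE] : root (b r) (w r).
    by rewrite rootE power_binomialE subrr mulr0.
  exists (A * (\prod_(i | (i != j) && (i != r)) b i ^+ 2) * b' ^+ 2).
  by rewrite /G /B (bigD1 r) //= bE exprMn; ring.
have Gr0 r g : r != j -> (g * G).[w r] = 0 /\ (g * G)^`().[w r] = 0.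
  move=> /Gr [G' ->]; rewrite expr2 !mulrA derivM derivB derivX derivC subr0.
  by rewrite !hornerE subrr; split; ring.
have sH : (size H <= T.+1)%N by exact: size_power_binomial.
have sB : (size B <= (K.-1 * T).*2.+1)%N.
  have -> : (K.-1 * T).*2.+1 = (\sum_(r < K | r != j) T.*2).+1.
    rewrite sum_nat_const (eq_card (B := predC1 j)) // cardC1 card_ord.
    by rewrite -doubleMr.
  apply: (big_ind2 (fun (p : {poly R[i]}) n => (size p <= n.+1)%N)).
  - by rewrite size_poly1.
  - move=> p m p' m' sp sp'; apply: leq_trans (size_polyMleq _ _) _.
    rewrite -subn1 leq_subLR; lia.
  - move=> r rj; have := size_power_binomial (q r) (d r)^-1 (w r).
    rewrite -/(b r) expr2 => sb; apply: leq_trans (size_polyMleq _ _) _.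
    have := qT r rj; lia.
have sA : (size A <= T)%N by exact: size_poly.
have sG : (size G <= T + (K.-1 * T).*2)%N.
  by apply: leq_trans (size_polyMleq _ _) _; lia.
(* sizes: [T] for the averaging kernel, [T] for [H], [2 T] for each other node *)
have KT : (T + T + (K.-1 * T).*2 = K.*2 * T)%N by case: (K) K0 => // k _; lia.
have mH : multiplier_bound H (2 / T%:R).
  rewrite -(_ : cmod (T%:R * w j ^+ T.-1)^-1 = T%:R^-1).
    exact: multiplier_power_binomial.
  by rewrite cmodV cmodM cmod_nat cmodX w1 expr1n mulr1.
have cG : coef_bound G (kernel_bound K T D).
  rewrite /G /kernel_bound; have -> : ((2 / D) ^+ 2) ^+ K.-1
      = \prod_(r < K | r != j) ((2 / D) * (2 / D)).
    by rewrite prodr_const (eq_card (B := predC1 j)) // cardC1 card_ord -expr2.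
  suff : multiplier_bound B (\prod_(r < K | r != j) ((2 / D) * (2 / D))).
    by apply; exact: coef_averaging_kernel.
  apply: multiplier_bound_prod => r rj; rewrite expr2.
  have br : multiplier_bound (b r) (2 / D).
    apply: multiplier_bound_le (multiplier_power_binomial _ _ (w1 r)).
    rewrite cmodV ler_pM2l // lef_pV2 ?posrE ?cmod_gt0 ?d0 //; exact: wD.
  exact: multiplier_boundM.
(* each factor contributes at most [T / D] and occurs twice *)
have G'b : cmod G^`().[w j] <= T%:R + 2 * K%:R * T%:R / D.
  rewrite /G derivM hornerD !hornerM B1 averaging_kernel_at // mulr1 mul1r.
  apply: le_trans (cmodD _ _) _; apply: lerD.
    exact: cmod_deriv_averaging_kernel.
  rewrite deriv_prod_at => [|r rj]; last by rewrite expr2 hornerM b1 // mulr1.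
  apply: le_trans (cmod_sum _ _ _) _.
  apply: (@le_trans _ _ (\sum_(r < K) 2 * T%:R / D)); last first.
    by rewrite sumr_const card_ord -[leLHS]mulr_natr; lra.
  rewrite big_mkcond /=; apply: ler_sum => r _; case: ifP => rj; last first.
    by rewrite !mulr_ge0 ?invr_ge0 ?(ltW D0).
  rewrite expr2 derivM hornerD !hornerM b1 // mulr1 mul1r.
  apply: le_trans (cmodD _ _) _.
  suff : cmod (b r)^`().[w j] <= T%:R / D by lra.
  rewrite deriv_power_binomialE !cmodM cmodV cmod_nat cmodX w1 expr1n mulr1 mulrC.
  apply: ler_pM; rewrite ?invr_ge0 ?cmod_ge0 ?ler_nat ?qT //.
  rewrite lef_pV2 ?posrE ?cmod_gt0 ?d0 //; exact: wD.
clearbody G H.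
pose U : {poly R[i]} := 1 - G^`().[w j] *: H.
have sU : (size U <= T.+1)%N.
  apply: leq_trans (size_polyD _ _) _; rewrite size_polyN geq_max size_poly1 /=.
  exact: leq_trans (size_scale_leq _ _) sH.
exists (U * G), (H * G); split.
- by split; apply: leq_trans (size_polyMleq _ _) _; lia.
- move=> r; have [->|rj] := eqVneq r j; last exact: Gr0.
  rewrite derivM derivB -polyC1 derivC derivZ !hornerE G1 H0 H1 /= mulr1n.
  by split; ring.
- move=> r; have [->|rj] := eqVneq r j; last exact: Gr0.
  by rewrite derivM !hornerE G1 H0 H1 /= mulr1n; split; ring.
- rewrite mulrC.
  suff /(_ _ _ cG) : multiplier_bound (1 - G^`().[w j] *: H) (3 + 4 * K%:R / D).
    by [].
  apply: (@multiplier_bound_le _ _ (1 + (2 / T%:R) * cmod G^`().[w j])).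
    have -> : 3 + 4 * K%:R / D
        = 1 + 2 / T%:R * (T%:R + 2 * K%:R * T%:R / D).
      by field; rewrite !gt_eqF.
    by rewrite lerD2l ler_wpM2l // divr_ge0.
  apply: multiplier_boundD; first exact: multiplier_bound1.
  apply: multiplier_boundN; rewrite -mul_polyC mulrC.
  apply: multiplier_boundM => //; exact: multiplier_boundC.
- by rewrite mulrC; exact: mH.
Qed.

End Kernels.

(** * Left inverses of the Jacobian *)

Section LeftInverse.
Variables (R : realType) (K : nat).
Implicit Type x : 'rV[R[i]]_(K.*2).

Lemma index_cases (a : 'I_(K.*2)) :
  exists j : 'I_K, a = amp_index j \/ a = node_index j.
Proof.
have aK : (a./2 < K)%N by have := ltn_ord a; lia.
exists (Ordinal aK); case: (boolP (odd a)) => oa; [right|left];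
  apply: val_inj => /=; have := odd_double_half a.
  by rewrite oa add1n.
by rewrite (negPf oa) add0n.
Qed.

(** The rows are the coefficients of the Hermite polynomials at the points
    [node x j ^+ p].  A node column of the Jacobian carries the factor
    [amp x j * p * node x j ^+ p.-1], of modulus [|a_j| p], which the node rows
    divide out. *)
Lemma power_sums_left_inverse p n T x (q : 'I_K -> 'I_K -> nat)
    (D : 'I_K -> R) :
  (0 < p)%N -> (0 < T)%N -> (K.*2 * T <= n)%N ->
  (forall j, cmod (node x j) = 1) -> (forall j, amp x j <> 0) ->
  (forall j, 0 < D j) ->
  (forall j r, r != j -> (q j r <= T)%N) ->
  (forall j r, r != j -> D j <= cmod ((node x j ^+ p) ^+ q j r
                                      - (node x r ^+ p) ^+ q j r)) ->
  exists L : 'M[R[i]]_(K.*2, n),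
    L *m (jacobian (power_sums p n) x)^T = 1%:M /\
    forall j k,
      cmod (L (amp_index j) k) <= kernel_bound K T (D j) * (3 + 4 * K%:R / D j)
      /\ cmod (L (node_index j) k)
         <= kernel_bound K T (D j) * (2 / T%:R) / (cmod (amp x j) * p%:R).
Proof.
move=> p0 T0 KTn z1 a0 D0 qT zD.
have w1 r : cmod (node x r ^+ p) = 1 by rewrite cmodX z1 expr1n.
have rowP (a : 'I_(K.*2)) : exists Q : {poly R[i]},
    [/\ forall b, \sum_(k < n) Q`_k * jacobian (power_sums p n) x b k
          = (b == a)%:R,
        forall j, a = amp_index j ->
          coef_bound Q (kernel_bound K T (D j) * (3 + 4 * K%:R / D j)) &
        forall j, a = node_index j -> coef_bound Q
          (kernel_bound K T (D j) * (2 / T%:R) / (cmod (amp x j) * p%:R))].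
  have [j ja] := index_cases a.
  have [P [Q [[sP sQ] Pz Qz Pb Qb]]] :=
    hermite_dual_pair T0 (D0 j) w1 (qT j) (zD j).
  have sPn := leq_trans sP KTn; have sQn := leq_trans sQ KTn.
  case: ja => ->.
    exists P; split=> [b|i /amp_index_inj <- //|i /eqP]; last first.
      by rewrite amp_node_index.
    have [r [->|->]] := index_cases b.
      by rewrite coef_jacobian_amp // (Pz r).1 (inj_eq (@amp_index_inj K)).
    rewrite coef_jacobian_node // (Pz r).2 mulr0.
    by rewrite eq_sym amp_node_index.
  set c := amp x j * (p%:R * node x j ^+ p.-1).
  have c0 : c != 0.
    rewrite !mulf_neq0 ?expf_neq0 ?pnatr_eq0 -?lt0n //; first exact/eqP.
    by rewrite -cmod_gt0 z1.
  have sQc : (size (c^-1 *: Q) <= n)%N by rewrite size_scale ?invr_eq0.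
  exists (c^-1 *: Q); split=> [b|i /eqP|i /node_index_inj <- k].
  - have [r [->|->]] := index_cases b.
      rewrite coef_jacobian_amp // hornerZ (Qz r).1 mulr0.
      by rewrite amp_node_index.
    rewrite coef_jacobian_node // derivZ hornerZ (Qz r).2.
    rewrite (inj_eq (@node_index_inj K)).
    have [->|_] := eqVneq r j; last by rewrite !mulr0.
    by rewrite mulr1 mulfV.
  - by rewrite eq_sym amp_node_index.
  - rewrite coefZ cmodM cmodV !cmodM cmod_nat cmodX z1 expr1n mulr1 mulrC.
    by rewrite ler_wpM2r ?invr_ge0 ?mulr_ge0 ?cmod_ge0.
have [Q QP] := choice rowP.
exists (\matrix_(a, k) (Q a)`_k); split=> [|j k].
  apply/matrixP => a b; rewrite !mxE eq_sym.
  have [<- _ _] := QP a; apply: eq_bigr => k _; rewrite !mxE //.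
rewrite !mxE; have [_ Qa _] := QP (amp_index j).
have [_ _ Qn] := QP (node_index j).
by split; [exact: Qa|exact: Qn].
Qed.

Lemma total_amp_ge0 x : 0 <= total_amp x.
Proof. by apply: sumr_ge0 => j _; exact: cmod_ge0. Qed.

Lemma cmod_power_sums p n x i : (forall j, cmod (node x j) = 1) ->
  cmod (power_sums p n x ord0 i) <= total_amp x.
Proof.
move=> z1; rewrite mxE; apply: le_trans (cmod_sum _ _ _) _.
by apply: ler_sum => j _; rewrite cmodM cmodX z1 expr1n mulr1.
Qed.

Lemma cond_sum_le p n x m (B : 'M[R[i]]_(m, n)) a s :
  (forall j, cmod (node x j) = 1) -> \sum_(i < n) cmod (B a i) <= s ->
  \sum_(i < n) cmod (B a i) * cmod (power_sums p n x ord0 i)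
    <= total_amp x * s.
Proof.
move=> z1 Bs; apply: le_trans (ler_wpM2l (total_amp_ge0 x) Bs).
rewrite mulr_sumr; apply: ler_sum => i _; rewrite mulrC ler_wpM2r ?cmod_ge0 //.
exact: cmod_power_sums.
Qed.

End LeftInverse.

(** * Angular separations *)

Section Separation.
Variables (R : realType) (K : nat).
Implicit Type x : 'rV[R[i]]_(K.*2).

Lemma node_sep_le x j r :
  r != j -> node_sep x j <= angle_dist (node x j) (node x r).
Proof. by move=> rj; rewrite /node_sep; exact: bigmin_le_cond. Qed.

Lemma min_sep_le x j : min_sep x <= node_sep x j.
Proof. by rewrite /min_sep; exact: bigmin_le. Qed.

Lemma le_max_sep x j r :
  r != j -> angle_dist (node x j) (node x r) <= max_sep x.
Proof.
move=> rj; rewrite /max_sep; apply: le_trans (le_bigmax _ _ j).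
exact: (le_bigmax_cond _ (fun r => angle_dist (node x j) (node x r)) rj).
Qed.

Lemma node_sep_gt0 x j : (forall j, cmod (node x j) = 1) ->
  injective (node x) -> 0 < node_sep x j.
Proof.
move=> z1 zI; apply: lt_bigmin; first exact: pi_gt0.
move=> r rj; apply: angle_dist_gt0 => // /zI e; by rewrite e eqxx in rj.
Qed.

Lemma node_sep_le_max_sep x j : (1 < K)%N -> node_sep x j <= max_sep x.
Proof.
move=> K1; have [r rj] : exists r : 'I_K, r != j.
  have : (0 < #|predC1 j|)%N by rewrite cardC1 card_ord; lia.
  by case/card_gt0P => r; exists r.
exact: le_trans (node_sep_le x rj) (le_max_sep x rj).
Qed.

End Separation.

(** * Choosing the exponents *)

Section Regimes.
Variables (R : realType) (K : nat).

Lemma decimation_bounds N : (0 < K)%N -> (K.*2 <= N)%N -> let T := (N %/ K.*2)%N in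
  [/\ (0 < T)%N, (K.*2 * T <= N)%N & (N <= 4 * K * T)%N].
Proof.
move=> K0 KN T; have T0 : (0 < T)%N by rewrite divn_gt0 // double_gt0.
have NE := divn_eq N K.*2; have Nr : (N %% K.*2 < K.*2)%N.
  by rewrite ltn_pmod // double_gt0.
by split=> //; rewrite NE -/T; nia.
Qed.

(** Take [q] the integer part of [pi / d]: then [pi - d < q * d <= pi], and
    [q * d >= d] since [q >= 1], so [q * d >= pi / 2]. *)
Lemma separating_power (d : R) (T : nat) : 0 < d -> d <= pi -> pi < T%:R * d ->
  exists q : nat, [/\ (q <= T)%N, q%:R * d <= pi & 1 <= q%:R * d].
Proof.
move=> d0 dpi Td; have p0 := @pi_gt0 R; have p2 := @pi_ge2 R.
have pd0 : 0 <= pi / d by rewrite divr_ge0 // ltW.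
have /andP[q1 q2] := truncn_itv pd0.
set q := Num.trunc (pi / d) in q1 q2.
rewrite ler_pdivlMr // in q1; rewrite ltr_pdivrMr // in q2.
exists q; split=> //.
  by rewrite -ltnS -(ltr_nat R) -(ltr_pM2r d0) (le_lt_trans q1) //
    (lt_trans Td) // ltr_pM2r // ltr_nat.
rewrite -natr1 mulrDl mul1r in q2.
have q0 : (0 < q)%N.
  by rewrite lt0n; apply/eqP => q0; move: q2; rewrite q0 mul0r add0r ltNge dpi.
have : 1 * d <= q%:R * d by rewrite ler_pM2r // ler1n.
lra.
Qed.

(** Each pair of nodes has its own exponent, adapted to its angle by
    [separating_power]; chords of angle at least 1 are at least [1 / 2]. *)
Lemma well_separated_left_inverse N (x : 'rV[R[i]]_(K.*2)) :
  (0 < K)%N -> (K.*2 <= N)%N -> (forall j : 'I_K, cmod (node x j) = 1) ->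
  (forall j : 'I_K, amp x j <> 0) -> 4 * K%:R * pi < N%:R * min_sep x ->
  exists L : 'M[R[i]]_(K.*2, N), L *m prony_jacobian N x = 1%:M /\
    forall j k,
      cmod (L (amp_index j) k) <=
        kernel_bound K (N %/ K.*2) (2^-1 : R) * (3 + 4 * K%:R / 2^-1) /\
      cmod (L (node_index j) k) <= kernel_bound K (N %/ K.*2) (2^-1 : R)
        * (2 / (N %/ K.*2)%:R) / cmod (amp x j).
Proof.
move=> K1 KN z1 a0 sep; have [] := decimation_bounds K1 KN.
set T := (N %/ K.*2)%N => T0 KT NT.
pose d j r := angle_dist (node x j) (node x r).
have qP j r : exists q : nat, r != j ->
    [/\ (q <= T)%N, q%:R * d j r <= pi & 1 <= q%:R * d j r].
  have [->|rj] := eqVneq r j; first by exists 0%N.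
  have dsep : min_sep x <= d j r := le_trans (min_sep_le x j) (node_sep_le x rj).
  have N0 : (0 : R) < N%:R by rewrite ltr0n; lia.
  have K0 : (0 : R) < 4 * K%:R by rewrite mulr_gt0 // ltr0n.
  have sep' : 4 * K%:R * pi < N%:R * d j r.
    by apply: lt_le_trans sep _; rewrite ler_pM2l.
  have d0 : 0 < d j r.
    by rewrite -(pmulr_rgt0 _ N0) (lt_trans _ sep') // mulr_gt0 // pi_gt0.
  have [|q qd] := @separating_power (d j r) T d0 (angle_dist_le_pi _ _).
    rewrite -(ltr_pM2l K0) (lt_le_trans sep') // mulrA ler_pM2r //.
    by rewrite -!natrM ler_nat.
  by exists q.
have [q qd] := choice (fun jr : 'I_K * 'I_K => qP jr.1 jr.2).
have half0 : (0 : R) < 2^-1 by rewrite invr_gt0.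
have [j r rj|j r rj|L [LJ Lb]] := @power_sums_left_inverse R K 1 N T x
  (fun j r => q (j, r)) (fun=> 2^-1) isT T0 KT z1 a0 (fun=> half0).
- by have [] := qd (j, r) rj.
- rewrite !expr1; have [_ h1 h2] := qd (j, r) rj.
  apply: le_trans (power_chord_ge (z1 j) (z1 r) h1).
  by rewrite -[leLHS]mul1r ler_pM2r.
exists L; rewrite /prony_jacobian prony_mapE; split=> // j k.
by have [la ln] := Lb j k; rewrite mulr1 in ln.
Qed.


(** The decimated angles are at most [pi] by the choice of [p], and at least
    [N / (4 * K)] times the original ones, whence chords of length at least
    [D j]. *)
Lemma clustered_left_inverse N (x : 'rV[R[i]]_(K.*2)) :
  (0 < K)%N -> (K.*2 <= N)%N -> (forall j : 'I_K, cmod (node x j) = 1) ->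
  (forall j : 'I_K, amp x j <> 0) -> injective (node x) ->
  N%:R * max_sep x < 2 * pi * K%:R ->
  let p := (N %/ K.*2)%N in
  let D j := N%:R * node_sep x j / (8 * K%:R) in
  exists L : 'M[R[i]]_(K.*2), L *m decimated_jacobian p x = 1%:M /\
    forall j k,
      cmod (L (amp_index j) k) <=
        kernel_bound K 1 (D j) * (3 + 4 * K%:R / D j) /\
      cmod (L (node_index j) k) <=
        kernel_bound K 1 (D j) * 2 / (cmod (amp x j) * p%:R).
Proof.
move=> K1 KN z1 a0 zI sep p D; have [p0 pN Np] := decimation_bounds K1 KN.
have N0 : (0 : R) < N%:R by rewrite ltr0n; lia.
have K0 : (0 : R) < K%:R by rewrite ltr0n.
have D0 j : 0 < D j.
  by rewrite divr_gt0 ?mulr_gt0 // node_sep_gt0.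
have KK : (K.*2 * 1 <= K.*2)%N by rewrite muln1.
have [j r rj|L [LJ Lb]] := @power_sums_left_inverse R K p K.*2 1 x
  (fun _ _ => 1%N) D p0 isT KK z1 a0 D0 (fun _ _ _ => leqnn _).
  set d := angle_dist (node x j) (node x r).
  have d0 : 0 <= d by exact: angle_dist_ge0.
  have pd : p%:R * d <= pi.
    have pNR : 2 * K%:R * p%:R <= N%:R :> R.
      by rewrite -!natrM ler_nat mul2n.
    rewrite -(@ler_pM2l _ (2 * K%:R)) ?mulr_gt0 // mulrA.
    apply: le_trans (ler_wpM2r d0 pNR) _.
    apply: le_trans (_ : N%:R * max_sep x <= _); last by rewrite ltW // mulrAC.
    by rewrite ler_pM2l // le_max_sep.
  rewrite !expr1; apply: le_trans (power_chord_ge (z1 j) (z1 r) pd).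
  rewrite -/d /D ler_pdivrMr ?mulr_gt0 //.
  have NpR : N%:R <= 4 * K%:R * p%:R :> R by rewrite -!natrM ler_nat.
  apply: le_trans (ler_pM (ltW N0) (ltW (node_sep_gt0 j z1 zI)) NpR
    (node_sep_le x rj)) _.
  rewrite -/d; lra.
exists L; rewrite /decimated_jacobian decimated_prony_mapE; split=> // j k.
by have := Lb j k; rewrite divr1.
Qed.

End Regimes.

(** * The condition numbers *)

Theorem theorem6p1 (R : realType) (K : nat) (hK : (2 <= K)%N) :
  (exists K0 C : R, forall (N : nat) (x : 'rV[R[i]]_(K.*2)),
     (K.*2 <= N)%N ->
     (forall j : 'I_K, cmod (node x j) = 1) ->
     (forall j : 'I_K, amp x j <> 0) ->
     injective (node x) ->
     K0 < N%:R * min_sep x ->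
     \rank (prony_jacobian N x) = K.*2 /\
     forall j : 'I_K,
       cond_number N (amp_index j) x <= C * total_amp x /\
       cond_number N (node_index j) x
         <= C * (total_amp x / cmod (amp x j)) * (1 / N%:R))
  /\
  (forall A : R, exists C' : R, forall (N : nat) (x : 'rV[R[i]]_(K.*2)),
     (forall j : 'I_K, cmod (node x j) = 1) ->
     (forall j : 'I_K, amp x j <> 0) ->
     injective (node x) ->
     total_amp x = A ->
     (K.*2 <= N)%N ->
     N%:R * max_sep x < 2 * pi * K%:R ->
     let p := (N %/ K.*2)%N in
     decimated_jacobian p x \in unitmx /\
     forall j : 'I_K,
       decimated_cond_number p (amp_index j) x
         <= C' * (1 / (N%:R * node_sep x j) ^+ K.*2) /\
       decimated_cond_number p (node_index j) x
         <= C' * (1 / cmod (amp x j))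
            * (node_sep x j / (N%:R * node_sep x j) ^+ K.*2)).
Proof.
have K0 : (0 : R) < K%:R by rewrite ltr0n ltnW.
have K2 : (2 : R) <= K%:R by rewrite ler_nat.
split.
  pose S : R := ((2 / 2^-1) ^+ 2) ^+ K.-1.
  have S0 : 0 < S by rewrite !exprn_gt0 // divr_gt0 // invr_gt0.
  (* [4 * K * T >= N] for [T = N %/ K.*2], so [N * min_sep > 4 * K * pi] makes
     [T * min_sep] exceed [pi] *)
  exists (4 * K%:R * pi), (64 * K%:R ^+ 2 * S) => N x KN z1 a0 zI sep.
  have [T0 KT NT] := decimation_bounds (ltnW hK) KN.
  have [L [LJ Lb]] := well_separated_left_inverse (ltnW hK) KN z1 a0 sep.
  have TR0 : (0 : R) < (N %/ K.*2)%:R by rewrite ltr0n.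
  have NTR : (N%:R : R) <= 4 * K%:R * (N %/ K.*2)%:R.
    by rewrite -!natrM ler_nat.
  have N0 : (0 : R) < N%:R by rewrite ltr0n; lia.
  have hi : (0 : R) < 2^-1 by rewrite invr_gt0.
  move: LJ Lb; rewrite /kernel_bound -/S; set T : R := (N %/ K.*2)%:R in TR0 NTR *.
  move=> LJ Lb; split.
    apply/eqP; rewrite eqn_leq rank_leq_col /=.
    by rewrite -{1}(mxrank1 R[i] K.*2) -LJ mxrankM_maxr.
  move=> j; have aj : 0 < cmod (amp x j) by rewrite cmod_gt0; apply/eqP.
  rewrite /cond_number prony_mapE.
  have NT1 : N%:R / T <= 4 * K%:R by rewrite ler_pdivrMr.
  split.
    have s0 : 0 < T^-1 * S * (3 + 4 * K%:R / 2^-1).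
      by rewrite !mulr_gt0 ?invr_gt0 // ltr_wpDl // divr_gt0 // mulr_gt0.
    have := moore_penrose_row_sum_le LJ s0 (fun k => (Lb j k).1).
    move=> /(cond_sum_le 1 z1) /le_trans; apply.
    rewrite mulrC ler_wpM2r ?total_amp_ge0 //.
    have -> : N%:R * (T^-1 * S * (3 + 4 * K%:R / 2^-1))
      = (N%:R / T) * (S * (3 + 8 * K%:R)).
      by rewrite invrK; field; rewrite gt_eqF.
    apply: le_trans (ler_wpM2r _ NT1) _; first by rewrite mulr_ge0 ?ltW //; lra.
    rewrite [leRHS]mulrC mulrCA ler_pM2l // expr2 -mulrA; nra.
  have s0 : 0 < T^-1 * S * (2 / T) / cmod (amp x j).
    by rewrite !mulr_gt0 ?invr_gt0.
  have := moore_penrose_row_sum_le LJ s0 (fun k => (Lb j k).2).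
  move=> /(cond_sum_le 1 z1) /le_trans; apply.
  have -> : 64 * K%:R ^+ 2 * S * (total_amp x / cmod (amp x j)) * (1 / N%:R)
    = total_amp x * ((64 * K%:R ^+ 2 / N%:R) * S / cmod (amp x j)).
    by field; rewrite !gt_eqF.
  rewrite ler_wpM2l ?total_amp_ge0 //.
  have -> : N%:R * (T^-1 * S * (2 / T) / cmod (amp x j))
    = (2 * (N%:R / T) * (N%:R / T) / N%:R) * S / cmod (amp x j).
    by field; rewrite !gt_eqF.
  rewrite ler_pM2r ?invr_gt0 // ler_pM2r // ler_pM2r ?invr_gt0 //.
  have : (N%:R / T) * (N%:R / T) <= (4 * K%:R) * (4 * K%:R).
    by apply: ler_pM => //; rewrite divr_ge0 ?ltW.
  rewrite expr2; nra.
move=> A; pose S : R := (256 * K%:R ^+ 2) ^+ K.-1.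
have S0 : 0 < S by rewrite exprn_gt0 // mulr_gt0 // exprn_gt0.
(* [256 * K^2] is [(2 / D)^2 * E^2] for [D = E / (8 * K)], and [448 * K^3]
   bounds the remaining polynomial in [E] by means of [E <= 8 * K] and
   [2 <= K] *)
exists (A * (2 * K%:R * S * (448 * K%:R ^+ 3))) => N x z1 a0 zI <- KN sep p.
have [p0 KT NT] := decimation_bounds (ltnW hK) KN.
have [L [LJ Lb]] := clustered_left_inverse (ltnW hK) KN z1 a0 zI sep.
have [LE Ju] : invmx (decimated_jacobian p x) = L
    /\ decimated_jacobian p x \in unitmx.
  have [_ Ju] := mulmx1_unit LJ; split=> //.
  by rewrite -[LHS]mul1mx -LJ mulmxK.
split=> // j; rewrite /decimated_cond_number LE decimated_prony_mapE.
have aj : 0 < cmod (amp x j) by rewrite cmod_gt0; apply/eqP.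
have N0 : (0 : R) < N%:R by rewrite ltr0n; lia.
have pR0 : (0 : R) < p%:R by rewrite ltr0n.
have NpR : (N%:R : R) <= 4 * K%:R * p%:R by rewrite -!natrM ler_nat.
have e0 := node_sep_gt0 j z1 zI.
set e := node_sep x j in e0 *; pose E := N%:R * e.
have E0 : 0 < E by rewrite mulr_gt0.
(* the cluster hypothesis; it allows inserting spare powers of [E] below *)
have E8 : E <= 8 * K%:R.
  have : E <= 2 * pi * K%:R.
    apply: le_trans (ltW sep); rewrite ler_pM2l //.
    exact: node_sep_le_max_sep.
  move/le_trans; apply; rewrite ler_pM2r //.
  have := @pihalf_lt2 R; lra.
have DE : N%:R * e / (8 * K%:R) = E / (8 * K%:R) by [].
have kE : kernel_bound K 1 (E / (8 * K%:R)) = S / (E ^+ 2) ^+ K.-1.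
  rewrite /kernel_bound invr1 mul1r -expr_div_n; congr (_ ^+ _).
  by field; rewrite !gt_eqF.
have Epow : E ^+ K.*2 = (E ^+ 2) ^+ K.-1 * E ^+ 2.
  by rewrite -exprSr prednK ?(ltnW hK) // -exprM mul2n.
have F0 : 0 < (E ^+ 2) ^+ K.-1 by rewrite !exprn_gt0.
set F := (E ^+ 2) ^+ K.-1 in kE Epow F0.
have sumc (a : 'I_(K.*2)) s : (forall k, cmod (L a k) <= s) ->
    \sum_(k < K.*2) cmod (L a k) <= 2 * K%:R * s.
  move=> Ls; apply: le_trans (ler_sum _ (fun k _ => Ls k)) _.
  by rewrite sumr_const card_ord -[leLHS]mulr_natl -mul2n natrM.
rewrite -/E Epow; split.
  have := sumc _ _ (fun k => (Lb j k).1).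
  move=> /(cond_sum_le p z1) /le_trans; apply.
  rewrite -/e DE kE -[leRHS]mulrA ler_wpM2l ?total_amp_ge0 //.
  have -> : 2 * K%:R * (S / F * (3 + 4 * K%:R / (E / (8 * K%:R))))
    = (2 * K%:R * S / F / E ^+ 2) * (3 * E ^+ 2 + 32 * K%:R ^+ 2 * E).
    by field; rewrite !gt_eqF.
  have -> : 2 * K%:R * S * (448 * K%:R ^+ 3) * (1 / (F * E ^+ 2))
    = (2 * K%:R * S / F / E ^+ 2) * (448 * K%:R ^+ 3).
    by field; rewrite !gt_eqF.
  rewrite ler_wpM2l //.
    by rewrite ltW // !mulr_gt0 ?invr_gt0 //; exact: exprn_gt0.
  have E2 : E ^+ 2 <= 64 * K%:R ^+ 2 by nra.
  have K23 : 2 * K%:R ^+ 2 <= K%:R ^+ 3 :> R.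
    by rewrite [leRHS]exprS ler_wpM2r // sqr_ge0.
  have K30 : (0 : R) < K%:R ^+ 3 by rewrite exprn_gt0.
  have : K%:R ^+ 2 * E <= 8 * K%:R ^+ 3.
    by rewrite [K%:R ^+ 3]exprSr [leRHS]mulrCA ler_wpM2l ?sqr_ge0.
  lra.
have := sumc _ _ (fun k => (Lb j k).2).
move=> /(cond_sum_le p z1) /le_trans; apply.
rewrite -/e DE kE.
have -> : total_amp x * (2 * K%:R * S * (448 * K%:R ^+ 3))
    * (1 / cmod (amp x j)) * (e / (F * E ^+ 2))
  = total_amp x * (2 * K%:R * S / F / cmod (amp x j)
      * (448 * K%:R ^+ 3 / (E * N%:R))).
  by rewrite /E; field; rewrite !gt_eqF.
rewrite ler_wpM2l ?total_amp_ge0 //.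
have -> : 2 * K%:R * (S / F * 2 / (cmod (amp x j) * p%:R))
  = 2 * K%:R * S / F / cmod (amp x j) * (2 / p%:R).
  by field; rewrite !gt_eqF.
rewrite ler_wpM2l //.
  by rewrite ltW // !mulr_gt0 ?invr_gt0.
rewrite ler_pdivrMr // mulrAC ler_pdivlMr ?mulr_gt0 //.
have EN : E * N%:R <= 8 * K%:R * (4 * K%:R * p%:R).
  by apply: ler_pM => //; exact: ltW.
have : 64 * K%:R ^+ 2 * p%:R <= 448 * K%:R ^+ 3 * p%:R :> R.
  rewrite ler_pM2r // [K%:R ^+ 3]exprS; nra.
lra.
Qed.
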